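(* Let $X$ be a nonempty set, let $\mathcal{D}_X=\{U\subseteq X\times X:\triangle\subseteq U\}$, and let $\mathcal{B}\subseteq\mathcal{D}_X$ be a nonempty family with the following properties: (BU1) for each $V\in\mathcal{B}$ there exists $U\in\mathcal{B}$ such that $U^{-1}\subseteq V$; (BU2) for each $V\in\mathcal{B}$ there exist $U,W\in\mathcal{B}$ such that $U\circ W\subseteq V$; (BU3) $\bigcap\mathcal{B}=\triangle$. Put $\mu=\{U\in\mathcal{D}_X:\text{there exists }B\in\mathcal{B}\text{ such that }B\subseteq U\}$. Then $\mu$ is a pre-uniform structure on $X$ and $\mathcal{B}$ is a pre-base for $\mu$. If, moreover, $X$ is a pre-topological space, the family $\mathcal{B}$ consists of open subsets of $X\times X$, and for each $x\in X$ and each open neighborhood $G$ of $x$ there is $V\in\mathcal{B}$ such that $V[x]\subseteq G$, then $\mu$ is a pre-uniformity on the pre-topological space $X$.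
   Context: A pre-topology on a set $Z$ is a family $\mathscr{T}\subseteq 2^{Z}$ with $\bigcup\mathscr{T}=Z$ that is closed under arbitrary unions (including the empty union); its members are called open. If $X$ is a pre-topological space, $X\times X$ carries the product pre-topology, whose open sets are the unions of sets $O_1\times O_2$ with $O_1,O_2$ open in $X$. For a nonempty set $X$ put $\triangle=\{(x,x):x\in X\}$; for $A,B\subseteq X\times X$ and $x\in X$ put $A^{-1}=\{(y,x):(x,y)\in A\}$, $A\circ B=\{(x,y): \exists z\in X,\ (x,z)\in A \text{ and } (z,y)\in B\}$, $A[x]=\{y\in X:(x,y)\in A\}$. A pre-uniform structure (pre-uniformity) on $X$ is a nonempty family $\mu$ of nonempty subsets of $X\times X$ such that: (U1) $\triangle\subseteq U$ for all $U\in\mu$; (U2) $U\in\mu$ implies $U^{-1}\in\mu$; (U3) for each $U\in\mu$ there are $V,W\in\mu$ with $V\circ W\subseteq U$; (U4) if $U\in\mu$ and $U\subseteq V\subseteq X\times X$ then $V\in\mu$; (U5) $\bigcap\mu=\triangle$. A family $\mathcal{B}\subseteq\mu$ is a pre-base for $\mu$ if each $V\in\mu$ contains some $W\in\mathcal{B}$. The induced pre-topology of $\mu$ is $\tau(\mu)=\{G\subseteq X:\text{for each }x\in G\text{ there is }U\in\mu\text{ with }U[x]\subseteq G\}$. A pre-uniformity $\mu$ on the set $X$ is said to be a pre-uniformity on the pre-topological space $X$ if $\tau(\mu)$ equals the given pre-topology of $X$. *)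

(* Defs.v *)
From mathcomp Require Import all_boot.
From mathcomp Require Import boolp classical_sets.

Set Implicit Arguments.
Unset Strict Implicit.
Unset Printing Implicit Defensive.

Local Open Scope classical_set_scope.

(* [F `<=` T] may be empty, so [set0] belongs to every pre-topology. *)
Record is_pretopology {Z : Type} (T : set (set Z)) : Prop := IsPretopology {
  pretop_cover : \bigcup_(O in T) O = [set: Z] ;
  pretop_bigcup : forall F : set (set Z), F `<=` T -> T (\bigcup_(O in F) O) }.

Definition prod_pretopology {X : Type} (T : set (set X)) : set (set (X * X)) :=
  [set W | exists2 F : set (set X * set X),
     F `<=` T `*` T & W = \bigcup_(P in F) (P.1 `*` P.2)].

(* [A o B] relates [x] to [y] when [A (x, z)] and [B (z, y)] for some [z].
   The library's [B \; A] also applies [A] first, hence the swap. *)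
Definition comp_rel {X : Type} (A B : set (X * X)) : set (X * X) :=
  (B \; A)%relation.

(* [A^-1] is the library's inverse in [relation_scope], [diagonal] is the
   diagonal of X * X, and [xsection A x] is A[x]. *)
Record is_preuniformity {X : Type} (mu : set (set (X * X))) : Prop :=
  IsPreuniformity {
  preunif_nonempty : mu !=set0 ;
  preunif_mem_nonempty : forall U, mu U -> U !=set0 ;
  preunif_diagonal : forall U, mu U -> diagonal `<=` U ;
  preunif_inv : forall U, mu U -> mu (U^-1)%relation ;
  preunif_comp : forall U, mu U ->
    exists V W, [/\ mu V, mu W & comp_rel V W `<=` U] ;
  preunif_up : forall U V, mu U -> U `<=` V -> mu V ;
  preunif_bigcap : \bigcap_(U in mu) U = diagonal }.

Definition is_prebase {X : Type} (mu B : set (set (X * X))) : Prop :=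
  B `<=` mu /\ forall V, mu V -> exists2 W, B W & W `<=` V.

Definition induced_pretopology {X : Type} (mu : set (set (X * X))) :
    set (set X) :=
  [set G | forall x, G x -> exists2 U, mu U & xsection U x `<=` G].

Definition is_preuniformity_on {X : Type} (T : set (set X))
    (mu : set (set (X * X))) : Prop :=
  is_preuniformity mu /\ induced_pretopology mu = T.

(* The family D_X of supersets of the diagonal. *)
Definition reflexive_sets (X : Type) : set (set (X * X)) :=
  [set U | diagonal `<=` U].
Arguments reflexive_sets X _ : clear implicits.

Definition generated_family {X : Type} (B : set (set (X * X))) :
    set (set (X * X)) :=
  [set U | reflexive_sets X U /\ exists2 V, B V & V `<=` U].

(* Main.v *)
Require Import Defs.
From mathcomp Require Import all_boot.
From mathcomp Require Import boolp classical_sets.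
Local Open Scope classical_set_scope.

(** The family generated by [B] is the upward closure of [B] among the
    reflexive relations.  The inverse and composition hypotheses on [B] hold up
    to inclusion, which is all that an upward closed family asks for; the
    inverse case also uses that inversion is a monotone involution.  The
    intersection is still the diagonal, since every added set contains it.

    That open sets are open for the pre-uniformity is the neighbourhood
    hypothesis.  The converse, [induced_generated_open], comes from the shape of
    the product: a member [V] of [B] is a union of open boxes, and [(x, x)],
    being in [V], lies in one of them, say [O1 `*` O2]; then [O2] is an open
    neighbourhood of [x] inside [V[x]].  So a set open for the pre-uniformity
    contains an open neighbourhood of each of its points, hence is a union of
    open sets. *)

Lemma pretop_locally {X : Type} (T : set (set X)) (G : set X) :
  is_pretopology T ->
  (forall x, G x -> exists O, [/\ T O, O x & O `<=` G]) -> T G.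
Proof.
move=> Ttop locG.
have -> : G = \bigcup_(O in [set O | T O /\ O `<=` G]) O.
  apply/seteqP; split=> [x /locG[O [TO Ox OG]]|x [O [_ OG] Ox]]; last exact: OG.
  by exists O.
by apply: (pretop_bigcup Ttop) => O [].
Qed.

(** A box containing the diagonal point [(x, x)] has [x] in both of its sides;
    its second side lies in the section at [x], and is open. *)
Lemma open_xsection_nbhs {X : Type} (T : set (set X)) (V : set (X * X)) (x : X) :
  prod_pretopology T V -> V (x, x) ->
  exists O, [/\ T O, O x & O `<=` xsection V x].
Proof.
move=> [F FT ->] [[O1 O2] FO /= [O1x O2x]].
exists O2; split=> //; first by have [] := FT _ FO.
by move=> y O2y; rewrite /xsection/= inE; exists (O1, O2).
Qed.

Section Generated.
Variables (X : Type) (B : set (set (X * X))).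
Hypothesis B_refl : B `<=` reflexive_sets X.

Lemma sub_generated_family : B `<=` generated_family B.
Proof. by move=> V BV; split; [exact: B_refl | exists V]. Qed.

Lemma generated_family_prebase : is_prebase (generated_family B) B.
Proof. by split=> [|V []]; first exact: sub_generated_family. Qed.

Lemma generated_family_preuniformity :
  [set: X] !=set0 -> B !=set0 ->
  (forall V, B V -> exists2 U, B U & (U^-1)%relation `<=` V) ->
  (forall V, B V -> exists U W, [/\ B U, B W & comp_rel U W `<=` V]) ->
  \bigcap_(V in B) V = diagonal ->
  is_preuniformity (generated_family B).
Proof.
move=> [x0 _] [V0 BV0] BU1 BU2 BU3; split.
- by exists V0; exact: sub_generated_family.
- by move=> U [Urefl _]; exists (x0, x0); exact: Urefl.
- by move=> U [].
- move=> U [Urefl [V BV VU]]; split.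
    by move=> [x y] /diagonalP /= <-; exact: Urefl.
  have [W BW WV] := BU1 _ BV.
  exists W => // -[x y] Wxy; apply: VU.
  exact: (WV (y, x)).
- move=> U [_ [V BV VU]]; have [W1 [W2 [BW1 BW2 W12]]] := BU2 _ BV.
  exists W1, W2; split; [exact: sub_generated_family..|].
  exact: subset_trans W12 VU.
- move=> U V [Urefl [W BW WU]] UV; split; first exact: subset_trans Urefl UV.
  by exists W => //; exact: subset_trans WU UV.
- apply/seteqP; split=> [p cap_p|p diag_p U [Urefl _]]; last exact: Urefl.
  by rewrite -BU3 => V BV; apply: cap_p; exact: sub_generated_family.
Qed.

Lemma induced_generated_open (T : set (set X)) :
  is_pretopology T -> B `<=` prod_pretopology T ->
  induced_pretopology (generated_family B) `<=` T.
Proof.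
move=> Ttop Bopen G Gind; apply: pretop_locally => // x Gx.
have [U [_ [V BV VU]] UG] := Gind x Gx.
have [O [TO Ox OV]] : exists O, [/\ T O, O x & O `<=` xsection V x].
  by apply: open_xsection_nbhs; [exact: Bopen | exact: B_refl].
exists O; split=> //.
exact: subset_trans OV (subset_trans (le_xsection VU) UG).
Qed.

End Generated.

Theorem proposition4p3 (X : Type) (B : set (set (X * X)))
    (X_nonempty : [set: X] !=set0)
    (B_refl : B `<=` reflexive_sets X)
    (B_nonempty : B !=set0)
    (BU1 : forall V, B V -> exists2 U, B U & (U^-1)%relation `<=` V)
    (BU2 : forall V, B V ->
       exists U W, [/\ B U, B W & comp_rel U W `<=` V])
    (BU3 : \bigcap_(V in B) V = diagonal) :
  (is_preuniformity (generated_family B) /\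
   is_prebase (generated_family B) B) /\
  (forall T : set (set X),
     is_pretopology T ->
     B `<=` prod_pretopology T ->
     (forall x G, T G -> G x -> exists2 V, B V & xsection V x `<=` G) ->
     is_preuniformity_on T (generated_family B)).
Proof.
have mu_unif : is_preuniformity (generated_family B).
  exact: generated_family_preuniformity.
split; first by split=> //; exact: generated_family_prebase.
move=> T Ttop Bopen Bnbhs; split=> //.
apply/seteqP; split; first exact: induced_generated_open.
move=> G TG x Gx; have [V BV VG] := Bnbhs x G TG Gx.
by exists V => //; exact: sub_generated_family.
Qed.
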